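(* Let $\mathcal{V}$ be a real vector space and let $\mathcal{R}$ be a set of rules on $\mathcal{V}$. Then a choice function $C$ is proper, binary and $\mathcal{R}$-compatible if and only if there is an $\mathcal{R}$-compatible proper order $\succ$ such that $C=C_{\succ}$. This order is unique and characterised by $$v\succ u\ \Leftrightarrow\ u\notin C(\{u,v\})\quad\text{for all }u,v\in\mathcal{V},$$ and it furthermore satisfies $K_C=K_{D_{\succ}}$.
   Context: $\mathcal{V}$ is a real vector space whose elements are called options. $\mathcal{Q}$ is the set of all non-empty (possibly infinite) subsets of $\mathcal{V}$, and $\mathcal{Q}_{\emptyset}:=\mathcal{Q}\cup\{\emptyset\}$. $\mathbb{R}_{>0}$ and $\mathbb{R}_{\geq0}$ are the positive and non-negative reals. For $A\in\mathcal{Q}$ and $w\in\mathcal{V}$, $A+w:=\{u+w\colon u\in A\}$ and $A-w:=\{u-w\colon u\in A\}$. A choice function is a map $C\colon\mathcal{Q}\to\mathcal{Q}_{\emptyset}$ with $C(A)\subseteq A$ for all $A\in\mathcal{Q}$ ($C(A)=\emptyset$ is allowed). For a choice function $C$, let $K_C:=\{A\in\mathcal{Q}\colon 0\notin C(A\cup\{0\})\}$. For $D\subseteq\mathcal{V}$, let $K_D:=\{A\in\mathcal{Q}\colon A\cap D\neq\emptyset\}$. For $\mathcal{A}\subseteq\mathcal{Q}$, $\Phi_{\mathcal{A}}$ is the set of all maps $\phi\colon\mathcal{A}\to\mathcal{V}$ with $\phi(A)\in A$ for all $A\in\mathcal{A}$. If $\mathcal{A}\neq\emptyset$, $\Lambda_{\mathcal{A}}$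 is the set of all maps $\lambda\colon\mathcal{A}\to\mathbb{R}_{\geq0}$ with finite non-empty support. A choice function $C$ is proper if: - PC0: $C(\{u\})=\{u\}$ for all $u\in\mathcal{V}$; - PC1: if $u\in C(A)$ then $u+w\in C(A+w)$, for all $A\in\mathcal{Q}$ and $u,w\in\mathcal{V}$; - PC2: if $\emptyset\neq\mathcal{A}\subseteq K_C$ and if, for all $\phi\in\Phi_{\mathcal{A}}$, $\lambda_\phi\in\Lambda_{\mathcal{A}}$, then $\{\sum_{A\in\mathcal{A}}\lambda_\phi(A)\phi(A)\colon\phi\in\Phi_{\mathcal{A}}\}\in K_C$; - PC3: if $u\in A\subseteq B$ and $u\in C(B)$, then $u\in C(A)$, for all $A,B\in\mathcal{Q}$. A choice function $C$ is binary if for all $A\in\mathcal{Q}$ and $u\in A$: $u\in C(A)$ if and only if $u\in C(\{u,v\})$ for all $v\in A\setminus\{u\}$. A binary relation $\succ$ on $\mathcal{V}$ is a proper order if, for all $u,v,w\in\mathcal{V}$ and $\lambda\in\mathbb{R}_{>0}$: $u\not\succ u$; if $u\succ v$ and $v\succ w$ then $u\succ w$; if $u\succ v$ then $\lambda u\succ\lambda v$; if $u\succ v$ then $u+w\succ v+w$. For a proper order $\succ$, $D_{\succ}:=\{u\in\mathcal{V}\colon u\succ0\}$ and $C_{\succ}(A):=\{u\in A\colon \text{there is no }v\in A\text{ with }v\succ u\}$ for $A\in\mathcal{Q}$. A set of rules is a subset $\mathcal{R}$ of $\mathcal{P}(\mathcal{Q})\times\mathcal{Q}_{\emptyset}$,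 where $\mathcal{P}(\mathcal{Q})$ is the power set of $\mathcal{Q}$. A proper order $\succ$ is $\mathcal{R}$-compatible if for all $(\mathcal{A},B)\in\mathcal{R}$: if $A\cap D_{\succ}\neq\emptyset$ for all $A\in\mathcal{A}$, then $B\cap D_{\succ}\neq\emptyset$. A proper choice function $C$ is $\mathcal{R}$-compatible if for all $(\mathcal{A},B)\in\mathcal{R}$: if $A\in K_C$ for all $A\in\mathcal{A}$, then $B\in K_C$. *)

(* Defs.v *)
From HB Require Import structures.
From mathcomp Require Import all_boot all_order all_algebra.
From mathcomp Require Import boolp classical_sets functions cardinality fsbigop.
From mathcomp Require Import reals.

Set Implicit Arguments.
Unset Strict Implicit.
Unset Printing Implicit Defensive.

Import Order.TTheory GRing.Theory Num.Theory.

Local Open Scope classical_set_scope.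
Local Open Scope ring_scope.

Section ChoiceFunctions.
Context {R : realType} {V : lmodType R}.

Definition option_sets : set (set V) := [set A | A !=set0].

Definition translate (A : set V) (w : V) : set V := [set u + w | u in A].

(* A choice function has domain [option_sets]; it is encoded as a total map on
   [set V], whose value at [set0] is irrelevant: every definition below only
   looks at [C A] for nonempty [A]. *)
Definition choice_function (C : set V -> set V) : Prop :=
  forall A, option_sets A -> C A `<=` A.

Definition K_choice (C : set V -> set V) : set (set V) :=
  [set A | option_sets A /\ ~ C (A `|` [set 0]) 0].

Definition K_set (D : set V) : set (set V) :=
  [set A | option_sets A /\ A `&` D !=set0].

(* The domain of selections and weights is the type of elements of [AA], not
   [set V]: in [PC2] the weights depend on the selection, which must therefore
   be determined by its values on [AA]. *)
Definition selections (AA : set (set V)) : set (AA -> V) :=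
  [set phi | forall A : AA, (val A : set V) (phi A)].

Definition weights (AA : set (set V)) : set (AA -> R) :=
  [set lam | (forall A, 0 <= lam A) /\
     finite_set [set A | lam A != 0] /\ [set A | lam A != 0] !=set0].

Definition PC0 (C : set V -> set V) : Prop :=
  forall u, C [set u] = [set u].

Definition PC1 (C : set V -> set V) : Prop :=
  forall A u w, option_sets A -> C A u -> C (translate A w) (u + w).

Definition PC2 (C : set V -> set V) : Prop :=
  forall (AA : set (set V)) (lam : (AA -> V) -> AA -> R),
    AA !=set0 -> AA `<=` K_choice C ->
    (forall phi, selections phi -> weights (lam phi)) ->
    K_choice C
      [set \sum_(A \in [set: AA]) lam phi A *: phi A | phi in @selections AA].

Definition PC3 (C : set V -> set V) : Prop :=
  forall A B u, option_sets A -> option_sets B ->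
    A u -> A `<=` B -> C B u -> C A u.

Definition proper_choice (C : set V -> set V) : Prop :=
  [/\ PC0 C, PC1 C, PC2 C & PC3 C].

Definition binary_choice (C : set V -> set V) : Prop :=
  forall A u, option_sets A -> A u ->
    (C A u <-> forall v, (A `\ u) v -> C [set u; v] u).

(* [gt u v] reads "u is strictly preferred to v". *)
Definition proper_order (gt : V -> V -> Prop) : Prop :=
  [/\ forall u, ~ gt u u,
      forall u v w, gt u v -> gt v w -> gt u w,
      forall u v (l : R), 0 < l -> gt u v -> gt (l *: u) (l *: v) &
      forall u v w, gt u v -> gt (u + w) (v + w)].

Definition order_positive (gt : V -> V -> Prop) : set V := [set u | gt u 0].

Definition order_choice (gt : V -> V -> Prop) (A : set V) : set V :=
  [set u | A u /\ ~ exists2 v, A v & gt v u].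

(* The conclusion [r.2] of a rule may be [set0], its premises may not contain
   [set0]. *)
Definition rule_set (rules : set (set (set V) * set V)) : Prop :=
  forall r, rules r -> r.1 `<=` option_sets.

Definition order_compatible (rules : set (set (set V) * set V))
    (gt : V -> V -> Prop) : Prop :=
  forall AA B, rules (AA, B) ->
    (forall A, AA A -> A `&` order_positive gt !=set0) ->
    B `&` order_positive gt !=set0.

Definition choice_compatible (rules : set (set (set V) * set V))
    (C : set V -> set V) : Prop :=
  forall AA B, rules (AA, B) ->
    (forall A, AA A -> K_choice C A) -> K_choice C B.

Definition represents (rules : set (set (set V) * set V))
    (C : set V -> set V) (gt : V -> V -> Prop) : Prop :=
  [/\ proper_order gt, order_compatible rules gt &
      forall A, option_sets A -> C A = order_choice gt A].

End ChoiceFunctions.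

(* Main.v *)
Require Import Defs.
From HB Require Import structures.
From mathcomp Require Import all_boot all_order all_algebra.
From mathcomp Require Import boolp classical_sets functions cardinality fsbigop.
From mathcomp Require Import reals.
Local Open Scope classical_set_scope.
Local Open Scope ring_scope.

(** A binary choice function is determined by its restriction to pairs, hence,
by translation invariance PC1, by the set of [x] with [{x}] in [K_choice C].
Applied to families of at most two singletons, each of which has only one
selection, PC2 says precisely that this set is a convex cone, that is, the
positive cone of a proper order. Conversely, if every member of a family meets
the positive cone [D], some selection takes all its values in [D], and the
combination that PC2 attaches to this selection lies again in [D]. *)

Import Order.TTheory GRing.Theory Num.Theory.

Section ConvexCone.
Context {R : realType} {V : lmodType R} {D : set V}.
Hypothesis DD : forall x y, D x -> D y -> D (x + y).
Hypothesis DZ : forall (l : R) x, 0 < l -> D x -> D (l *: x).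

(** [D] need not contain 0, so a sum of terms in [D] stays in [D] only if it is not empty. The
    weight at [a] secures one term in [D]; the rest is 0 or in [D], an alternative that survives
    addition. *)
Lemma cone_fsum {I : choiceType} {lam : I -> R} {f : I -> V} :
  (forall i, D (f i)) -> (forall i, 0 <= lam i) ->
  finite_set [set i | lam i != 0] -> [set i | lam i != 0] !=set0 ->
  D (\sum_(i \in [set: I]) lam i *: f i).
Proof.
move=> Df lam0 fin [a /= la].
have Dlam i : lam i != 0 -> D (lam i *: f i).
  by move=> li; apply: DZ => //; rewrite lt0r li lam0.
(* Restricting the index set to the support, which is finite, allows a term to be split off. *)
rewrite -(@fsbig_widen _ _ _ _ [set i | lam i != 0]) //; last first.
  by move=> i [_ /= /negP]; rewrite negbK => /eqP ->; rewrite scale0r.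
rewrite (fsbigD1 a) //=.
set s := (X in _ + X).
have [->|Ds] : s = 0 \/ D s; last 2 first.
- by rewrite addr0; apply: Dlam.
- exact: DD (Dlam _ la) Ds.
apply: (big_ind (fun x => x = 0 \/ D x)).
- by left.
- move=> x y [->|Dx] [->|Dy]; rewrite ?addr0 ?add0r; [by left|by right|by right|].
  by right; apply: DD.
- move=> i _; have [->|li] := eqVneq (lam i) 0.
    by left; rewrite scale0r.
  by right; apply: Dlam.
Qed.

End ConvexCone.

Section OrderChoice.
Context {R : realType} {V : lmodType R}.
Context {C : set V -> set V} {gt : V -> V -> Prop}.
Hypothesis gt_proper : proper_order gt.
Hypothesis C_gt : forall A, option_sets A -> C A = order_choice gt A.

(** Only [v] can exclude [u] from the choice, since [u] does not dominate itself. The order is thus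
    read off from [C], whence its uniqueness. *)
Lemma order_choice_pair u v : gt v u <-> ~ C [set u; v] u.
Proof.
have [irr _ _ _] := gt_proper.
rewrite C_gt; last by exists u; left.
split=> [vu [_]|nC].
  by apply; exists v => //; right.
apply: contrapT => nvu; apply: nC; split; first by left.
by move=> [w [->|->] //]; apply: irr.
Qed.

(** The option 0 added to [A] does not dominate itself, so whatever dominates it lies in [A]. *)
Lemma K_order_choice : K_choice C = K_set (order_positive gt).
Proof.
have [irr _ _ _] := gt_proper.
apply/seteqP; split=> A [A0]; last first.
  move=> [v [Av v0]]; split=> //; rewrite C_gt; last by exists 0; right.
  by move=> [_]; apply; exists v => //; left.
rewrite C_gt; last by exists 0; right.
move=> nC; split=> //; apply: contrapT => nv; apply: nC; split; first by right.
move=> [w [Aw|->] gw]; last exact: irr gw.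
by apply: nv; exists w.
Qed.

Lemma order_positiveD x y :
  order_positive gt x -> order_positive gt y -> order_positive gt (x + y).
Proof.
have [_ tr _ ad] := gt_proper.
move=> Dx Dy; apply: tr Dy; rewrite -[X in gt _ X]add0r.
exact: ad.
Qed.

Lemma order_positiveZ (l : R) x :
  0 < l -> order_positive gt x -> order_positive gt (l *: x).
Proof.
have [_ _ sc _] := gt_proper.
by move=> l0 /(sc _ _ _ l0); rewrite scaler0.
Qed.

Lemma order_choice_PC2 : PC2 C.
Proof.
move=> AA lam AA0; rewrite K_order_choice => AAK lamP.
have sel (A : AA) : exists x, (val A `&` order_positive gt) x.
  by have [_] := AAK _ (set_valP A).
have [phi phiP] := choice sel.
have phis : selections phi by move=> A; have [] := phiP A.
have [lam0 [fin ne]] := lamP _ phis.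
have im := imageP (fun phi => \sum_(A \in [set: AA]) lam phi A *: phi A) phis.
split; first by eexists; exact: im.
eexists; split; first exact: im.
apply: (cone_fsum order_positiveD order_positiveZ _ lam0 fin ne).
by move=> A; have [] := phiP A.
Qed.

Lemma order_choice_proper : proper_choice C.
Proof.
have [irr _ _ ad] := gt_proper.
split.
- move=> u; rewrite C_gt; last by exists u.
  apply/seteqP; split=> [v []//|v ->]; split=> //.
  by move=> [w -> ]; apply: irr.
- move=> A u w A0; rewrite !C_gt //; last first.
    by case: A0 => x Ax; exists (x + w); exists x.
  move=> [Au nv]; split; first by exists u.
  (* Translating back by [- w] turns a dominating option of the translate into one of [A]. *)
  move=> [_ [v Av <-] /(ad _ _ (- w))]; rewrite !addrK => vu.
  by apply: nv; exists v.
- exact: order_choice_PC2.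
- move=> A B u A0 B0 Au AB; rewrite !C_gt // => -[_ nv]; split=> //.
  by move=> [v Av vu]; apply: nv; exists v => //; apply: AB.
Qed.

Lemma order_choice_binary : binary_choice C.
Proof.
have [irr _ _ _] := gt_proper.
move=> A u A0 Au; rewrite C_gt //; split=> [[_ nv] v [Av _]|Cuv].
  apply: contrapT => /order_choice_pair vu.
  by apply: nv; exists v.
split=> // -[v Av vu].
have [/= vE|nvu] := pselect (v = u); first by apply: (irr u); rewrite -{1}vE.
by apply: ((order_choice_pair u v).1 vu); apply: Cuv.
Qed.

End OrderChoice.

(** Membership in [K_set] is meeting the cone plus being non-empty. For premises the latter comes
    from [rule_set]; a conclusion that meets the cone is non-empty anyway. *)
Lemma order_rule_compatible {R : realType} {V : lmodType R}
    {rules : set (set (set V) * set V)} {C : set V -> set V}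
    {gt : V -> V -> Prop} :
  rule_set rules -> K_choice C = K_set (order_positive gt) ->
  choice_compatible rules C <-> order_compatible rules gt.
Proof.
move=> hrules KE; rewrite /choice_compatible KE; split=> comp AA B rAB AAD.
  have [|//] := comp AA B rAB.
  by move=> A AAA; split; [exact: hrules rAB _ AAA|exact: AAD].
have [|x Bx] := comp AA B rAB.
  by move=> A /AAD[].
by split; exists x => //; case: Bx.
Qed.

Section BinaryChoice.
Context {R : realType} {V : lmodType R} {C : set V -> set V}.
Hypothesis C_proper : proper_choice C.

(** The only candidate: by [order_choice_pair], every proper order that induces [C] coincides with
    it. *)
Definition pair_order (v u : V) : Prop := ~ C [set u; v] u.

Lemma pair_order_translate w v u :
  pair_order v u -> pair_order (v + w) (u + w).
Proof.
have [_ pc1 _ _] := C_proper.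
move=> vu; apply: contra_not vu => /(pc1 _ _ (- w)).
rewrite addrK /translate image_setU !image_set1 !addrK.
by apply; exists (u + w); left.
Qed.

Lemma pair_order_sub v u : pair_order v u <-> pair_order (v - u) 0.
Proof.
split=> [/(pair_order_translate (- u))|/(pair_order_translate u)].
  by rewrite subrr.
by rewrite subrK add0r.
Qed.

Lemma K_choice_set1 x : K_choice C [set x] <-> pair_order x 0.
Proof.
rewrite /K_choice /pair_order /= setUC.
by split=> [[]//|?]; split=> //; exists x.
Qed.

Lemma pair_order_comb (l m : R) x y :
  0 < l -> 0 < m -> pair_order x 0 -> pair_order y 0 ->
  pair_order (l *: x + m *: y) 0.
Proof.
have [_ _ pc2 _] := C_proper.
move=> l0 m0 /K_choice_set1 Kx /K_choice_set1 Ky; apply/K_choice_set1.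
pose AA : set (set V) := [set [set x]; [set y]].
pose a : AA := SigSub (mem_set (or_introl erefl : AA [set x])).
pose b : AA := SigSub (mem_set (or_intror erefl : AA [set y])).
have AAE : [set: AA] = [set a; b].
  apply/seteqP; split=> // A _.
  by have [AE|AE] := set_valP A; [left|right]; apply: val_inj.
have AAfin : finite_set [set: AA] by rewrite AAE; exact: finite_set2.
have AAK : AA `<=` K_choice C by move=> _ [->|->].
(* The two indicators are added so that [a = b], that is, [x = y], needs no
   separate treatment. *)
pose lam (phi : AA -> V) (A : AA) : R := l *+ (A == a) + m *+ (A == b).
have lamP phi : selections phi -> weights (lam phi).
  move=> _; split=> [A|]; first by rewrite addr_ge0 // mulrn_wge0 // ltW.
  split; first exact: sub_finite_set AAfin.
  exists a => /=; rewrite /lam eqxx gt_eqF //.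
  by rewrite ltr_pwDl // mulrn_wge0 // ltW.
have sumE phi : selections phi ->
    \sum_(A \in [set: AA]) lam phi A *: phi A = l *: x + m *: y.
  have one (c : AA) (k : R) (f : AA -> V) :
      \sum_(A \in [set: AA]) (k *+ (A == c)) *: f A = k *: f c.
    rewrite -(@fsbig_widen _ _ _ _ [set c]) //.
      by rewrite fsbig_set1 eqxx.
    by move=> A [_ /= /eqP/negPf ->]; rewrite scale0r.
  move=> phiP; under eq_fsbigr do rewrite scalerDl.
  by rewrite fsbig_split // !one (phiP a : phi a = x) (phiP b : phi b = y).
(* Non-emptiness, which is part of [K_choice], hands over a selection [phi]; as all selections give
   the same sum by [sumE], the set in PC2 is a singleton. *)
have [[z [phi phiP zE]] nC] := pc2 AA lam (ex_intro _ _ (set_valP a)) AAK lamP.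
rewrite (_ : [set _] = [set \sum_(A \in [set: AA]) lam psi A *: psi A |
                         psi in @selections _ _ AA]).
  by split => //; exists z, phi.
apply/seteqP; split=> [_ ->|_ [psi /sumE psiE <-]] //=.
by exists phi => //; exact: sumE.
Qed.

Lemma pair_order_proper : proper_order pair_order.
Proof.
have [pc0 _ _ _] := C_proper.
have irr u : ~ pair_order u u.
  by rewrite /pair_order setUid pc0; apply.
split=> //.
- move=> u v w /pair_order_sub uv /pair_order_sub vw; apply/pair_order_sub.
  (* The differences telescope: [u - w] is the sum of [u - v] and [v - w]. *)
  have := pair_order_comb _ _ _ _ ltr01 ltr01 uv vw.
  by rewrite !scale1r addrA subrK.
- move=> u v l l0 /pair_order_sub uv; apply/pair_order_sub.
  (* [pair_order_comb] takes two positive coefficients, so [l] is split into two halves applied to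
     the same vector. *)
  have l2 : 0 < l / 2 by rewrite divr_gt0.
  have := pair_order_comb _ _ _ _ l2 l2 uv uv.
  by rewrite -scalerDl -splitr scalerBr.
- by move=> u v w; apply: pair_order_translate.
Qed.

Lemma binary_choiceE (A : set V) :
  choice_function C -> binary_choice C -> option_sets A ->
  C A = order_choice pair_order A.
Proof.
have [irr _ _ _] := pair_order_proper.
move=> hC hb A0; apply/seteqP; split=> u.
  move=> Cu; have Au := hC _ A0 _ Cu; split=> // -[v Av].
  (* Binarity compares [u] only with other options; irreflexivity settles the case [v = u]. *)
  have [->|vu] := pselect (v = u); first exact: irr.
  by apply; apply: (hb A u A0 Au).1.
move=> [Au nv]; apply/(hb A u A0 Au) => v [Av _].
by apply: contrapT => vu; apply: nv; exists v.
Qed.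

End BinaryChoice.

Theorem theorem5 (R : realType) (V : lmodType R)
    (rules : set (set (set V) * set V)) (C : set V -> set V)
    (hrules : rule_set rules) (hC : choice_function C) :
  (proper_choice C /\ binary_choice C /\ choice_compatible rules C <->
    exists gt : V -> V -> Prop, represents rules C gt) /\
  (forall gt : V -> V -> Prop, represents rules C gt ->
    [/\ forall gt' : V -> V -> Prop, represents rules C gt' -> gt' = gt,
        forall u v : V, gt v u <-> ~ C [set u; v] u &
        K_choice C = K_set (order_positive gt)]).
Proof.
split; [split=> [[Cp [Cb Cr]]|[gt [gtp gtr gtC]]]|move=> gt [gtp _ gtC]].
- have gtp := pair_order_proper Cp.
  have gtC A := binary_choiceE Cp A hC Cb.
  exists (@pair_order _ _ C); split=> //.
  exact: (order_rule_compatible hrules (K_order_choice gtp gtC)).1.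
- split; first exact: order_choice_proper gtp gtC.
  split; first exact: order_choice_binary gtp gtC.
  exact: (order_rule_compatible hrules (K_order_choice gtp gtC)).2.
- split=> [gt' [gtp' _ gtC']|u v|].
  + apply/funext => v; apply/funext => u; apply/propext.
    by rewrite (order_choice_pair gtp gtC) (order_choice_pair gtp' gtC').
  + exact: order_choice_pair gtp gtC u v.
  + exact: K_order_choice gtp gtC.
Qed.
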